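(* For every integer $k\geq 2$, if a graph $G$ has minimum degree $\delta\geq 2k^2$, then $G$ is $\frac{1}{k}$-majority $(k+1)$-edge-colourable.
   Context: Graphs are finite and simple. For an integer $k\geq 2$, a $\frac{1}{k}$-majority $l$-edge-colouring of a graph $G$ is an assignment to each edge of $G$ of one of $l$ colours such that for every colour $i$ and every vertex $v$ of $G$, at most $\frac{d_G(v)}{k}$ of the edges incident with $v$ have colour $i$ (where $d_G(v)$ is the degree of $v$). $G$ is $\frac{1}{k}$-majority $l$-edge-colourable if such a colouring exists. *)

(* Defs.v *)
From HB Require Import structures.
From mathcomp Require Import all_boot all_order all_algebra.

Set Implicit Arguments.
Unset Strict Implicit.
Unset Printing Implicit Defensive.

(* Edges are the 2-element sets of vertices, so there are no loops and no
   parallel edges. *)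
Record sgraph := SGraph {
  vertex :> finType;
  edges : {set {set vertex}};
  edges_card2 : forall e : {set vertex}, e \in edges -> #|e| = 2
}.

Definition edge (G : sgraph) := {e : {set G} | e \in edges G}.

Definition degree (G : sgraph) (v : G) : nat :=
  #|[set e in edges G | v \in e]|.

(* The initial value #|G| exceeds every degree, so for a graph with at least
   one vertex this is exactly the least degree (see min_degree_geP and
   min_degree_attained); for the graph without vertices it is 0. *)
Definition min_degree (G : sgraph) : nat :=
  \big[minn/#|G|]_(v : G) degree v.

Definition colour_degree (G : sgraph) (l : nat) (c : edge G -> 'I_l)
    (i : 'I_l) (v : G) : nat :=
  #|[set e : edge G | (v \in val e) && (c e == i)]|.

(* The bound is a genuine rational inequality: d(v) / k is not rounded. *)
Definition majority_edge_colouring (k l : nat) (G : sgraph)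
    (c : edge G -> 'I_l) : Prop :=
  forall (i : 'I_l) (v : G),
    ((colour_degree c i v)%:R <= (degree v)%:R / k%:R :> rat)%R.

Definition majority_edge_colourable (k l : nat) (G : sgraph) : Prop :=
  exists c : edge G -> 'I_l, majority_edge_colouring k c.

Lemma degree_lt_card (G : sgraph) (v : G) : degree v < #|G|.
Proof.
rewrite /degree; have G_gt0 : 0 < #|G| by apply/card_gt0P; exists v.
have sub : [set e in edges G | v \in e] \subset
    [set [set v; w] | w in [set~ v]].
  apply/subsetP => e; rewrite inE => /andP[eE ve].
  have /eqP/cards2P[x [y [xy def_e]]] := edges_card2 eE.
  move: ve; rewrite def_e !inE => /orP[] /eqP ->; apply/imsetP.
    by exists y; rewrite // !inE eq_sym.
  by exists x; rewrite ?inE // setUC.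
rewrite -(prednK G_gt0) ltnS -(cardsC1 v).
exact: leq_trans (subset_leq_card sub) (leq_imset_card _ _).
Qed.

Lemma min_degree_geP (G : sgraph) (m : nat) : 0 < #|G| ->
  reflect (forall v : G, m <= degree v) (m <= min_degree G).
Proof.
move=> G_gt0; apply: (iffP idP) => [le_m v|le_m].
  apply: leq_trans le_m _; rewrite /min_degree.
  elim: (index_enum G) (mem_index_enum v) => // w s IHs.
  rewrite inE big_cons => /predU1P[<-|/IHs]; first exact: geq_minl.
  exact: leq_trans (geq_minr _ _).
rewrite /min_degree; apply: (big_ind (fun n => m <= n)) => [|x y mx my|v _] //.
  have /card_gt0P[v0 _] := G_gt0.
  exact: leq_trans (le_m v0) (ltnW (degree_lt_card v0)).
by rewrite leq_min mx.
Qed.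

Lemma min_degree_attained (G : sgraph) : 0 < #|G| ->
  exists v : G, min_degree G = degree v.
Proof.
move=> G_gt0; have /card_gt0P[v0 _] := G_gt0.
case: (arg_minnP (@degree G) (isT : predT v0)) => v _ vmin; exists v.
apply/eqP; rewrite eqn_leq; apply/andP; split.
  by move/(min_degree_geP _ G_gt0): (leqnn (min_degree G)); apply.
by apply/(min_degree_geP _ G_gt0) => w; apply: vmin.
Qed.

(* Main.v *)
Require Import Defs.
From mathcomp Require Import all_boot all_order all_algebra.
From mathcomp Require Import zify.

(** Orient every edge arbitrarily and read the graph as a bipartite multigraph
    with tails on one side and heads on the other.  Cutting each vertex of this
    bipartite graph into pieces of degree at most [k + 1] and applying König's
    edge-colouring theorem gives [k + 1] colours such that each colour occurs at
    [v] at most [ceil (d1 / (k + 1)) + ceil (d2 / (k + 1))] times, where [d1] and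
    [d2] are the out- and in-degree of [v].  This number [n] satisfies
    [n (k + 1) <= d + 2 k], which forces [n k <= d] once [2 k ^ 2 <= d]. *)

Set Implicit Arguments.
Unset Strict Implicit.
Unset Printing Implicit Defensive.

(** * König's edge-colouring theorem for bipartite multigraphs *)

Section Koenig.

Variables (E : finType) (A B : eqType) (s : E -> A) (t : E -> B).

(** [E] is the edge set of a bipartite multigraph with end maps [s] and [t]. A partial colouring is
    a total function whose values outside [S] are ignored. *)
Definition proper_on (C : eqType) (S : {set E}) (c : E -> C) : Prop :=
  {in S &, forall e e',
    c e = c e' -> (s e == s e') || (t e == t e') -> e = e'}.

Section KempeSwap.

Variables (C : eqType) (S : {set E}) (c : E -> C).
Hypothesis cP : proper_on S c.
Variables (a b : C) (e0 : E).
Hypothesis neq_ab : a != b.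
Hypotheses (e0S : e0 \in S) (ce0 : c e0 = b).
Hypothesis a_missing : {in S, forall e, c e = a -> s e != s e0}.

(* One step along the alternating path that leaves [s e0] through [e0]. *)
Definition kempe_step : rel E := fun e e' =>
  [&& e \in S, e' \in S &
    [&& c e == b, c e' == a & t e == t e'] ||
    [&& c e == a, c e' == b & s e == s e']].

Definition kempe_chain : {set E} := [set e | connect kempe_step e0 e].

Lemma kempe_chain_pred e : e \in kempe_chain ->
  e = e0 \/ exists2 e', e' \in kempe_chain & kempe_step e' e.
Proof.
rewrite inE => /connectP[p]; case/lastP: p => [|p z] /=; first by left.
rewrite rcons_path last_rcons => /andP[pP stepz] ->; right.
by exists (last e0 p) => //; rewrite inE; apply/connectP; exists p.
Qed.

Lemma kempe_chain_step e e' :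
  e \in kempe_chain -> kempe_step e e' -> e' \in kempe_chain.
Proof. by rewrite !inE => ee' st; apply: connect_trans ee' (connect1 st). Qed.

Lemma kempe_chainS e : e \in kempe_chain -> e \in S.
Proof. by case/kempe_chain_pred => [->|[e' _ /and3P[]]]. Qed.

Lemma kempe_chain_colour e : e \in kempe_chain -> c e = a \/ c e = b.
Proof.
case/kempe_chain_pred => [->|[e' _ /and3P[_ _]]]; first by right.
by case/orP=> /and3P[_ /eqP-> _]; [left|right].
Qed.

(* Backward closure holds because a predecessor is determined by properness,
   and [e0] has none because [a] is missing at [s e0]. *)
Lemma kempe_chain_closed e e' : e \in kempe_chain -> e' \in S ->
  c e' = a \/ c e' = b -> (s e == s e') || (t e == t e') -> e' \in kempe_chain.
Proof.
move=> eK e'S ce' adj; have eS := kempe_chainS eK.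
have ba : (b == a) = false by rewrite eq_sym (negbTE neq_ab).
case: (eqVneq (c e) (c e')) => [ee'|nee']; first by rewrite -(cP eS e'S ee' adj).
case: (kempe_chain_colour eK) => ce.
  have {}ce' : c e' = b by case: ce' nee' => // ->; rewrite ce eqxx.
  case/orP: adj => adj.
    apply: kempe_chain_step eK _.
    by rewrite /kempe_step eS e'S ce ce' !eqxx adj orbT.
  case: (kempe_chain_pred eK) => [ee0|[f fK /and3P[fS _]]].
    by move: ce0; rewrite -ee0 ce => /eqP; rewrite (negbTE neq_ab).
  rewrite ce !eqxx (negbTE neq_ab) /= andbF orbF => /andP[/eqP cf /eqP tf].
  by rewrite -(cP fS e'S) // ?cf ?ce' // tf adj orbT.
have {}ce' : c e' = a by case: ce' nee' => // ->; rewrite ce eqxx.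
case/orP: adj => adj; last first.
  apply: kempe_chain_step eK _.
  by rewrite /kempe_step eS e'S ce ce' !eqxx adj.
case: (kempe_chain_pred eK) => [ee0|[f fK /and3P[fS _]]].
  by have := a_missing e'S ce'; rewrite -(eqP adj) ee0 eqxx.
rewrite ce !eqxx ba /= andbF /= => /andP[/eqP cf /eqP sf].
by rewrite -(cP fS e'S) // ?cf ?ce' // sf adj.
Qed.

Definition kempe_swap (e : E) : C :=
  if e \in kempe_chain then (if c e == a then b else a) else c e.

(** The swap exchanges [a] and [b] on the chain, so it keeps distinct colours distinct there. By
    closure, an edge outside the chain that meets it has neither colour. *)
Lemma kempe_swap_proper : proper_on S kempe_swap.
Proof.
have sym e e' : e \in kempe_chain -> e' \notin kempe_chain -> e' \in S ->
    kempe_swap e = kempe_swap e' -> (s e == s e') || (t e == t e') -> False.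
  move=> eK e'K e'S; rewrite /kempe_swap eK (negbTE e'K) => ce' adj.
  case/negP: e'K; apply: (kempe_chain_closed eK) => //.
  by case: ifP ce' => _ <-; [right|left].
move=> e e' eS e'S.
have [eK|eK] := boolP (e \in kempe_chain);
  have [e'K|e'K] := boolP (e' \in kempe_chain).
- move=> ee'; apply: cP => //; move: ee'; rewrite /kempe_swap eK e'K.
  case: (kempe_chain_colour eK) (kempe_chain_colour e'K) => [] -> [] ->;
    rewrite // eqxx eq_sym (negbTE neq_ab) => // /eqP;
    by rewrite 1?eq_sym (negbTE neq_ab).
- by move=> ee' adj; case: (sym e e').
- move=> ee' adj; case: (sym e' e) => //.
  by rewrite eq_sym (eq_sym (t e')).
by rewrite /kempe_swap (negbTE eK) (negbTE e'K); apply: cP.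
Qed.

Lemma kempe_swap_missing_start e : e \in S -> kempe_swap e = b -> s e != s e0.
Proof.
move=> eS; apply: contra_eqN => /eqP se; rewrite /kempe_swap.
have e0K : e0 \in kempe_chain by rewrite inE connect0.
case: ifPn => [eK|eK].
  case: ifP => [/eqP ce|_]; last by [].
  by have := a_missing eS ce; rewrite se eqxx.
apply: contraNneq eK => ce.
by apply: kempe_chain_closed e0K eS _ _; [right|rewrite se eqxx].
Qed.

(** This is where bipartiteness enters: the chain always reaches the [t] side along an edge of
    colour [b]. An edge recoloured from [a] to [b] thus shares its [t] end with a [b]-edge, and [y]
    has none. *)
Lemma kempe_swap_missing_end y :
  {in S, forall e, c e = b -> t e != y} ->
  {in S, forall e, kempe_swap e = b -> t e != y}.
Proof.
move=> by_ e eS; rewrite /kempe_swap; case: ifP => [eK|_]; last exact: by_.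
case: eqP => [ce _|_ /eqP]; last by rewrite (negbTE neq_ab).
case: (kempe_chain_pred eK) => [ee0|[f fK /and3P[fS _]]].
  by move: ce0 => /eqP; rewrite -ee0 ce (negbTE neq_ab).
rewrite ce !eqxx (negbTE neq_ab) /= andbF orbF => /andP[/eqP cf /eqP <-].
exact: by_.
Qed.

End KempeSwap.

Variable l : nat.

(** The edge [e1] lies in its own fibre but outside [S], so fewer than [l] edges of [S] share this
    end with it. *)
Lemma missing_colour (A' : eqType) (s' : E -> A') (S : {set E})
    (c : E -> 'I_l) (e1 : E) :
  #|[set e | s' e == s' e1]| <= l -> e1 \notin S ->
  exists i : 'I_l, {in S, forall e, c e = i -> s' e != s' e1}.
Proof.
move=> le_l e1S; pose F := [set e in S | s' e == s' e1].
have ltF : #|c @: F| < #|'I_l|.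
  rewrite card_ord; apply: leq_ltn_trans (leq_imset_card _ _) _.
  apply: leq_trans le_l; apply: proper_card; apply/properP; split.
    by apply/subsetP => e; rewrite !inE => /andP[].
  by exists e1; rewrite !inE ?eqxx // (negbTE e1S).
have /existsP[i iF] : [exists i, i \notin c @: F].
  apply: contraLR ltF; rewrite negb_exists -leqNgt => /forallP allF.
  by rewrite subset_leq_card //; apply/subsetP => i _; have := allF i; rewrite negbK.
exists i => e eS ce; apply: contra iF => se.
by rewrite -ce imset_f // inE eS.
Qed.

Lemma extend_proper (C : eqType) (S : {set E}) (c : E -> C) (e1 : E) (i : C) :
  proper_on S c ->
  {in S, forall e, c e = i -> s e != s e1} ->
  {in S, forall e, c e = i -> t e != t e1} ->
  proper_on (e1 |: S) (fun e => if e == e1 then i else c e).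
Proof.
move=> cP si ti e e'; rewrite !inE.
case: eqVneq => [->|ne] /= eS; case: eqVneq => [->|ne'] //= e'S; last exact: cP.
  move=> /esym ce'; rewrite (eq_sym (s e1)) (eq_sym (t e1)).
  by rewrite (negbTE (si _ e'S ce')) (negbTE (ti _ e'S ce')).
by move=> ce; rewrite (negbTE (si _ eS ce)) (negbTE (ti _ eS ce)).
Qed.

(** Induction on the number of coloured edges. For a new edge [e1], some [a] is free at [s e1] and
    some [b] at [t e1]; a Kempe swap, if required, makes [b] free at both ends. *)
Theorem koenig_edge_colouring : 0 < l ->
  (forall x, #|[set e | s e == x]| <= l) ->
  (forall y, #|[set e | t e == y]| <= l) ->
  exists c : E -> 'I_l, proper_on setT c.
Proof.
move=> l_gt0 sl tl.
suff: forall n (S : {set E}), #|S| = n -> exists c : E -> 'I_l, proper_on S c.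
  by move=> H; apply: (H _ setT).
elim=> [|n IHn] S cardS.
  exists (fun=> Ordinal l_gt0) => e e'.
  by move/eqP: cardS; rewrite cards_eq0 => /eqP->; rewrite inE.
have /card_gt0P[e1 e1S] : 0 < #|S| by rewrite cardS.
have cardS1 : #|S :\ e1| = n by move: cardS; rewrite (cardsD1 e1) e1S => -[].
have e1S1 : e1 \notin S :\ e1 by rewrite !inE eqxx.
have [c cP] := IHn _ cardS1; rewrite -(setD1K e1S).
have [a aP] := missing_colour c (sl (s e1)) e1S1.
have [b bP] := missing_colour c (tl (t e1)) e1S1.
(* If [b] is used at [s e1], by [e0] say, the chain leaving through [e0] is swapped; otherwise [e1]
   takes [b] at once. *)
have [/existsP[e0]|] := boolP [exists e in S :\ e1, (c e == b) && (s e == s e1)].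
  case/and3P=> e0S /eqP ce0 /eqP se0.
  have neq_ab : a != b.
    by apply/eqP => ab; have := aP _ e0S; rewrite ab se0 eqxx => /(_ ce0).
  rewrite -se0 in aP.
  eexists; apply: (@extend_proper _ _ (kempe_swap (S :\ e1) c a b e0) _ b).
  - exact: kempe_swap_proper.
  - by rewrite -se0; apply: kempe_swap_missing_start.
  - exact: kempe_swap_missing_end.
rewrite negb_exists => /forallP nob.
eexists; apply: (@extend_proper _ _ c _ b) => // e eS ce.
by have := nob e; rewrite eS ce eqxx.
Qed.

End Koenig.

(** * Balanced colourings by splitting vertices *)

Section BalancedColouring.

Variables (E : finType) (l : nat).

(** Number the edges of each fibre and cut it into blocks of [l.+1] consecutive indices; [u e] is
    the block of [e]. The bound on [u e] is the fibre size over [l.+1], rounded up. *)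
Lemma split_fibres (A : eqType) (s : E -> A) :
  exists u : E -> nat,
    (forall x, #|[set e | (s e, u e) == x]| <= l.+1) /\
    (forall e, u e < (#|[set e' | s e' == s e]| + l) %/ l.+1).
Proof.
pose idx e := index e (enum [set e' | s e' == s e]).
have idx_inj e e' : s e = s e' -> idx e = idx e' -> e = e'.
  move=> se; rewrite /idx se => eqi; apply: (index_inj e _ _ eqi).
    by rewrite mem_enum inE se.
  by rewrite mem_enum inE.
exists (fun e => idx e %/ l.+1); split=> [[x q]|e].
  (* Within one block, the index modulo [l.+1] determines the edge. *)
  pose r e : 'I_l.+1 := Ordinal (ltn_pmod (idx e) (ltn0Sn l)).
  set F := [set e | _].
  suff r_inj : {in F &, injective r}.
    by rewrite -(card_in_imset r_inj) -[leqRHS]card_ord max_card.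
  move=> e e'; rewrite !inE => /eqP[se qe] /eqP[se' qe'] /(congr1 val) /= re.
  apply: idx_inj; first by rewrite se se'.
  by rewrite (divn_eq (idx e) l.+1) (divn_eq (idx e') l.+1) qe qe' re.
have lt_idx : idx e < #|[set e' | s e' == s e]|.
  by rewrite /idx cardE index_mem mem_enum inE.
by rewrite leq_divRL // mulSn; have := leq_divM (idx e) l.+1; lia.
Qed.

Lemma card_fibre_colour (A : eqType) (s : E -> A) (u : E -> nat) (n : nat)
    (F : {set E}) (a : A) :
  {in F, forall e, s e = a /\ u e < n} ->
  {in F &, forall e e', (s e, u e) = (s e', u e') -> e = e'} -> #|F| <= n.
Proof.
case: n => [|n] ltn inj.
  by rewrite leqn0 cards_eq0; apply/eqP/setP => e; rewrite inE;
     apply/negP => /ltn[].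
suff r_inj : {in F &, injective (fun e => inord (u e) : 'I_n.+1)}.
  by rewrite -(card_in_imset r_inj) -[leqRHS]card_ord max_card.
move=> e e' eF e'F /(congr1 val) /=.
have [[se ue] [se' ue']] := (ltn _ eF, ltn _ e'F).
by rewrite !inordK // => uu; apply: inj; rewrite // uu se se'.
Qed.

Theorem bipartite_balanced_colouring (A B : eqType) (s : E -> A) (t : E -> B) :
  exists c : E -> 'I_l.+1, forall i,
    (forall x, #|[set e | (s e == x) && (c e == i)]| <=
                 (#|[set e | s e == x]| + l) %/ l.+1) /\
    (forall y, #|[set e | (t e == y) && (c e == i)]| <=
                 (#|[set e | t e == y]| + l) %/ l.+1).
Proof.
have [u [u_fib u_lt]] := split_fibres s.
have [w [w_fib w_lt]] := split_fibres t.
(* The vertices are now the pieces [(s e, u e)] and [(t e, w e)]. Each piece meets a colour at most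
   once, so the number of pieces bounds the colour's count at the original vertex. *)
have [c cP] := koenig_edge_colouring (ltn0Sn l) u_fib w_fib.
exists c => i; split=> x.
  apply: (@card_fibre_colour _ s u _ _ x) => [e|e e'].
    by rewrite inE => /andP[/eqP <- _].
  rewrite !inE => /andP[_ /eqP ce] /andP[_ /eqP ce'] su.
  by apply: cP; rewrite ?inE ?ce ?ce' // su eqxx.
apply: (@card_fibre_colour _ t w _ _ x) => [e|e e'].
  by rewrite inE => /andP[/eqP <- _].
rewrite !inE => /andP[_ /eqP ce] /andP[_ /eqP ce'] tw.
by apply: cP; rewrite ?inE ?ce ?ce' // tw eqxx orbT.
Qed.

End BalancedColouring.

(** * Transfer to simple graphs and the final estimate *)

Lemma edge_orientation (G : sgraph) :
  exists st : edge G -> G * G,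
    forall e, (st e).1 != (st e).2 /\ val e = [set (st e).1; (st e).2].
Proof.
have ends (e : edge G) : exists p : G * G, (p.1 != p.2) && (val e == [set p.1; p.2]).
  have /eqP/cards2P[x [y [xy ->]]] := edges_card2 (valP e).
  by exists (x, y); rewrite xy /=.
by exists (fun e => xchoose (ends e)) => e; have /andP[? /eqP] := xchooseP (ends e).
Qed.

Lemma majority_bound (k d d1 d2 n : nat) :
  2 * k ^ 2 <= d -> d1 + d2 <= d ->
  n <= (d1 + k) %/ k.+1 + (d2 + k) %/ k.+1 -> k * n <= d.
Proof.
move=> le_kd le_d le_n.
have le_nk : n * k.+1 <= d + 2 * k.
  apply: leq_trans (leq_mul le_n (leqnn _)) _; rewrite mulnDl.
  apply: leq_trans (leq_add (leq_divM _ _) (leq_divM _ _)) _; lia.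
(* If [d < k * n], then [le_nk] forces [n < 2 * k], whence [k * n <= 2 * k ^ 2 <= d], a
   contradiction. *)
have [//|lt_d] := leqP (k * n) d.
have lt_n : n < 2 * k by lia.
have le_kn : k * n <= k * (2 * k) by rewrite leq_mul2l (ltnW lt_n) orbT.
by move: le_kd; rewrite -mulnn; lia.
Qed.

Theorem theorem9 (k : nat) (hk : 2 <= k) (G : sgraph)
    (hG : 2 * k ^ 2 <= min_degree G) :
  majority_edge_colourable k k.+1 G.
Proof.
have [st stP] := edge_orientation G.
pose s e := (st e).1; pose t e := (st e).2.
have [c cP] := bipartite_balanced_colouring k s t.
exists c => i v; have [/(_ v) cs /(_ v) ct] := cP i.
(* Clearing the denominator leaves an inequality between natural numbers. *)
rewrite GRing.mulrC Num.Theory.ler_pdivlMl ?Num.Theory.ltr0n ?(ltnW hk) //.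
rewrite -GRing.natrM Num.Theory.ler_nat.
have degv : 2 * k ^ 2 <= degree v.
  have G_gt0 : 0 < #|G| by apply/card_gt0P; exists v.
  by move/(min_degree_geP _ G_gt0): hG.
have stv (e : edge G) : (v \in val e) = (s e == v) || (t e == v).
  by rewrite (stP e).2 !inE (eq_sym v) (eq_sym v (t e)).
have le_deg : #|[set e | s e == v]| + #|[set e | t e == v]| <= degree v.
  rewrite -cardsUI.
  (* No edge is a loop, so none is counted both as outgoing and as incoming at [v]. *)
  have -> : [set e | s e == v] :&: [set e | t e == v] = set0.
    apply/setP => e; rewrite !inE; apply/negP => /andP[/eqP sv /eqP tv].
    by have [] := stP e; rewrite -/(s e) -/(t e) sv tv eqxx.
  rewrite cards0 addn0 -(card_imset _ val_inj); apply: subset_leq_card.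
  apply/subsetP => _ /imsetP[e + ->].
  by rewrite !inE -stv (valP e).
have le_col : colour_degree c i v <=
    #|[set e | (s e == v) && (c e == i)]| + #|[set e | (t e == v) && (c e == i)]|.
  rewrite -cardsUI; apply: leq_trans (leq_addr _ _).
  by apply: subset_leq_card; apply/subsetP => e; rewrite !inE stv andb_orl.
exact: majority_bound degv le_deg (leq_trans le_col (leq_add cs ct)).
Qed.
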